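(* Suppose that the constraint qualification (CQ) stated in the context holds. For $\sigma>0$ consider $$(\mathrm{B})\quad \min_{\boldsymbol{x}\in\mathcal{X},\,\boldsymbol{y}\in\mathbb{R}^S_+,\,\boldsymbol{z}\in[0,1]^S}\Bigl\{f(\boldsymbol{x}):\ \sum_{s=1}^S z_s\ge S-m,\ V(\boldsymbol{y},\boldsymbol{z})=0,\ g_s(\boldsymbol{x})\le y_s\ \forall s\in[S]\Bigr\},$$ $$(\mathrm{B}_\sigma)\quad \min_{\boldsymbol{x}\in\mathcal{X},\,\boldsymbol{y}\in\mathbb{R}^S_+,\,\boldsymbol{z}\in[0,1]^S}\Bigl\{f(\boldsymbol{x})+\sigma V(\boldsymbol{y},\boldsymbol{z}):\ \sum_{s=1}^S z_s\ge S-m,\ g_s(\boldsymbol{x})\le y_s\ \forall s\in[S]\Bigr\},$$ where $V(\boldsymbol{y},\boldsymbol{z})=\sum_{s=1}^S y_sz_s$. Let $(\bar{\boldsymbol{x}},\bar{\boldsymbol{y}},\bar{\boldsymbol{z}})$ be feasible for $(\mathrm{B}_\sigma)$ (the feasible set does not depend on $\sigma$). Then the following two statements are equivalent: (a) $(\bar{\boldsymbol{x}},\bar{\boldsymbol{y}},\bar{\boldsymbol{z}})$ is a global minimizer of $(\mathrm{B})$; (b) $V(\bar{\boldsymbol{y}},\bar{\boldsymbol{z}})=0$ and there exists $\bar\sigma>0$ such that $(\bar{\boldsymbol{x}},\bar{\boldsymbol{y}},\bar{\boldsymbol{z}})$ is a global minimizer of $(\mathrm{B}_\sigma)$ for all 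$\sigma>\bar\sigma$.
   Context: $[n]=\{1,\dots,n\}$. Let $S,I$ be positive integers, $\alpha\in(0,1)$, $m=\lfloor\alpha S\rfloor$. Standing assumptions: $\mathcal{X}\subseteq\mathbb{R}^d$ is compact, convex, with nonempty relative interior, contained in an open set $\mathcal{U}\subseteq\mathbb{R}^d$; $f:\mathcal{U}\to\mathbb{R}$ is continuously differentiable and convex; for each $s\in[S]$ (scenario), $g_s(\boldsymbol{x})=\max_{i\in[I]}h_{s,i}(\boldsymbol{x})$ where each $h_{s,i}:\mathbb{R}^d\to\mathbb{R}$ is continuously differentiable and convex. Let $g_{(1)}(\boldsymbol{x})\le\cdots\le g_{(S)}(\boldsymbol{x})$ be the nondecreasing rearrangement of $(g_1(\boldsymbol{x}),\dots,g_S(\boldsymbol{x}))$, and define $$G_1(\boldsymbol{x})=\sum_{s=S-m}^{S}g_{(s)}(\boldsymbol{x}),\qquad G_2(\boldsymbol{x})=\sum_{s=S-m+1}^{S}g_{(s)}(\boldsymbol{x}),\qquad \phi(\boldsymbol{x})=G_1(\boldsymbol{x})-G_2(\boldsymbol{x}).$$ For a locally Lipschitz function $\phi$, the Clarke directional derivative is $\phi^\circ(\bar{\boldsymbol{x}};\boldsymbol{d})=\limsup_{\boldsymbol{x}\to\bar{\boldsymbol{x}},\,t\downarrow0}\frac{\phi(\boldsymbol{x}+t\boldsymbol{d})-\phi(\boldsymbol{x})}{t}$, which equals $\sup_{\boldsymbol{v}\in\partial\phi(\bar{\boldsymbol{x}})}\langle\boldsymbol{v},\boldsymbol{d}\rangle$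 with $\partial\phi$ the Clarke subdifferential; $\mathcal{T}_{\mathcal{X}}(\bar{\boldsymbol{x}})$ is the tangent cone of the convex set $\mathcal{X}$ at $\bar{\boldsymbol{x}}$. (CQ): for every $\bar{\boldsymbol{x}}\in\mathcal{X}$ with $\phi(\bar{\boldsymbol{x}})=0$ there exists $\boldsymbol{d}\in\mathcal{T}_{\mathcal{X}}(\bar{\boldsymbol{x}})$ such that $\phi^\circ(\bar{\boldsymbol{x}};\boldsymbol{d})<0$. *)

(* Defs.v *)
From HB Require Import structures.
From mathcomp Require Import all_boot all_order all_algebra.
From mathcomp Require Import all_classical all_reals all_analysis.

Set Implicit Arguments.
Unset Strict Implicit.
Unset Printing Implicit Defensive.

Import Order.TTheory GRing.Theory Num.Theory.
Import numFieldNormedType.Exports.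

Local Open Scope classical_set_scope.
Local Open Scope ring_scope.

(* A function on an open set U is represented by a total function whose values
   outside U are irrelevant; since U is open, the germ of f at a point of U only
   involves values in U. Continuity of every directional derivative
   x |-> 'd f x v is, in finite dimension, continuity of the gradient. *)
Definition C1_on (R : realType) (V : normedModType R) (U : set V)
    (f : V -> R^o) : Prop :=
  forall x, U x ->
    differentiable f x /\ (forall v : V, {for x, continuous (fun y => 'd f y v)}).

(* U is not assumed to be convex, so convexity of f on U is required along the
   segments contained in U; for convex U this is convex_function U f. *)
Definition convex_on (R : realType) (V : normedModType R) (U : set V)
    (f : V -> R^o) : Prop :=
  forall D : set V, convex_set D -> D `<=` U -> convex_function D f.

Definition affine_hull (R : realType) (V : normedModType R) (A : set V) : set V :=
  [set x | exists n (p : 'I_n -> V) (w : 'I_n -> R),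
     [/\ forall i, A (p i), \sum_i w i = 1 & x = \sum_i w i *: p i]].

Definition relative_interior (R : realType) (V : normedModType R) (A : set V) :
    set V :=
  [set x | A x /\ exists2 e : R, 0 < e & ball x e `&` affine_hull A `<=` A].

(* Tangent cone of convex analysis: the closure of the cone of feasible
   directions. It is meant for convex A and x in A. *)
Definition tangent_cone (R : realType) (V : normedModType R) (A : set V) (x : V) :
    set V :=
  closure [set v | exists t y, [/\ 0 <= t, A y & v = t *: (y - x)]].

(* limsup, in the extended reals, of the difference quotients as x' -> x and
   t -> 0 with t > 0. *)
Definition clarke_derivative (R : realType) (V : normedModType R) (phi : V -> R)
    (x v : V) : \bar R :=
  limf_esup (fun q : V * R => ((phi (q.1 + q.2 *: v) - phi q.1) / q.2)%:E)
            (filter_prod (nbhs x) (at_right (0 : R))).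

Definition global_minimizer (R : realType) (T : Type) (A : set T) (F : T -> R)
    (p : T) : Prop :=
  A p /\ forall q, A q -> F p <= F q.

(* The base value h s 0 x is itself one of the terms, so this is the maximum. *)
Definition scenario_max (R : realType) (V : Type) (nS nI : nat) (hI : (0 < nI)%N)
    (h : 'I_nS -> 'I_nI -> V -> R) (s : 'I_nS) (x : V) : R :=
  \big[Num.max/h s (Ordinal hI) x]_(i < nI) h s i x.

(* k-th smallest value, 1 <= k <= nS. *)
Definition order_stat (R : realType) (V : Type) (nS : nat) (g : 'I_nS -> V -> R)
    (k : nat) (x : V) : R :=
  nth 0 (sort <=%O [seq g s x | s <- enum 'I_nS]) k.-1.

Definition G1 (R : realType) (V : Type) (nS : nat) (g : 'I_nS -> V -> R) (m : nat)
    (x : V) : R :=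
  \sum_(nS - m <= k < nS.+1) order_stat g k x.

Definition G2 (R : realType) (V : Type) (nS : nat) (g : 'I_nS -> V -> R) (m : nat)
    (x : V) : R :=
  \sum_((nS - m).+1 <= k < nS.+1) order_stat g k x.

Definition phi (R : realType) (V : Type) (nS : nat) (g : 'I_nS -> V -> R) (m : nat)
    (x : V) : R :=
  G1 g m x - G2 g m x.

Definition CQ (R : realType) (V : normedModType R) (nS : nat)
    (g : 'I_nS -> V -> R) (m : nat) (X : set V) : Prop :=
  forall xbar, X xbar -> phi g m xbar = 0 ->
    exists2 v, tangent_cone X xbar v & (clarke_derivative (phi g m) xbar v < 0)%E.

Definition Vpen (R : realType) (nS : nat) (y z : 'rV[R]_nS) : R :=
  \sum_(s < nS) y 0 s * z 0 s.

Definition feasible_Bsigma (R : realType) (V : Type) (nS : nat)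
    (g : 'I_nS -> V -> R) (m : nat) (X : set V) :
    set (V * 'rV[R]_nS * 'rV[R]_nS) :=
  [set p : V * 'rV[R]_nS * 'rV[R]_nS | let: (x, y, z) := p in
     [/\ X x,
         forall s, 0 <= y 0 s,
         forall s, 0 <= z 0 s <= 1,
         nS%:R - m%:R <= \sum_(s < nS) z 0 s &
         forall s, g s x <= y 0 s]].

Definition feasible_B (R : realType) (V : Type) (nS : nat)
    (g : 'I_nS -> V -> R) (m : nat) (X : set V) :
    set (V * 'rV[R]_nS * 'rV[R]_nS) :=
  [set p : V * 'rV[R]_nS * 'rV[R]_nS | let: (_, y, z) := p in
     feasible_Bsigma g m X p /\ Vpen y z = 0].

Definition objective_B (R : realType) (V : Type) (nS : nat) (f : V -> R)
    (p : V * 'rV[R]_nS * 'rV[R]_nS) : R :=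
  let: (x, _, _) := p in f x.

Definition objective_Bsigma (R : realType) (V : Type) (nS : nat) (f : V -> R)
    (sigma : R) (p : V * 'rV[R]_nS * 'rV[R]_nS) : R :=
  let: (x, y, z) := p in f x + sigma * Vpen y z.

(* Main.v *)
Require Import Defs.
From HB Require Import structures.
From mathcomp Require Import all_boot all_order all_algebra.
From mathcomp Require Import all_classical all_reals all_analysis.
From mathcomp Require Import ring lra.

Set Implicit Arguments.
Unset Strict Implicit.
Unset Printing Implicit Defensive.

Import Order.TTheory GRing.Theory Num.Theory.
Import numFieldNormedType.Exports.

Local Open Scope classical_set_scope.
Local Open Scope ring_scope.

(** Write psi^+ for the positive part of psi and k = nS - m. The function phi is
    the k-th smallest of the g s, so phi x <= 0 says that at least k scenarios
    have g s x <= 0. Over the feasible points of (B_sigma) above a given x, the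
    penalty Vpen y z is at least phi^+ x: fewer than k scenarios have a value
    below phi x, so a vector z in the unit cube of total mass at least k puts
    mass at least 1 on scenarios of value at least phi x ([phi_le_Vpen]).
    Conversely each x in X with phi x <= 0 lifts to a feasible point of (B)
    ([feasible_B_lift]). The hard implication therefore amounts to exactness of
    the penalty phi^+ for minimizing f over X under phi <= 0.

    Exactness ([exact_penalty]) is proved by contradiction, without an error
    bound for the constraint. If no multiplier works, then for each n let u n
    minimize f + (n + 1) psi^+ over the compact set X. These points violate the
    constraint, and psi (u n) tends to 0 because f is bounded on X, so they have
    a cluster point p with psi p = 0. The constraint qualification at p gives a
    point w of X and a rate c > 0 such that, from every point near p, a small
    move towards w decreases psi at rate c ([feasible_descent_step]). Such a move
    from u n saves at least (n + 1) c per unit of step in the penalty, whereas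
    convexity of f bounds its cost by a multiple of max f - min f that does not
    depend on n. For large n this contradicts the minimality of u n.

    The Clarke derivative is transferred to nearby base points and directions by
    local Lipschitz continuity of phi, which holds since the functions h s i are
    convex and continuous and since maxima and order statistics are monotone and
    commute with adding a constant. *)

(** * Convexity and local Lipschitz continuity *)

Lemma convex_set_comb (R : realType) (V : normedModType R) (A : set V)
    (t : R) (x y : V) :
  convex_set A -> A x -> A y -> 0 <= t <= 1 -> A (t *: x + (1 - t) *: y).
Proof.
move=> cA Ax Ay /andP[t0 t1].
by have := cA x y (Itv01 t0 t1) (mem_set Ax) (mem_set Ay); rewrite inE.
Qed.

Lemma convex_function_comb (R : realType) (V : normedModType R) (A : set V)
    (f : V -> R^o) (t : R) (x y : V) :
  convex_function A f -> A x -> A y -> 0 <= t <= 1 ->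
  f (t *: x + (1 - t) *: y) <= t * f x + (1 - t) * f y.
Proof.
move=> cf Ax Ay /andP[t0 t1].
exact: (cf (Itv01 t0 t1) x y (mem_set Ax) (mem_set Ay)).
Qed.

(** A one-sided inequality suffices, since x and y may be exchanged. *)
Definition lipschitz_around (R : realType) (V : normedModType R) (psi : V -> R)
    (L e : R) (p : V) : Prop :=
  forall x y, ball p e x -> ball p e y -> psi x <= psi y + L * `|x - y|.

Definition locally_lipschitz (R : realType) (V : normedModType R) (psi : V -> R)
    (p : V) : Prop :=
  exists L e : R, [/\ 0 <= L, 0 < e & lipschitz_around psi L e p].

(** Extend the segment from y to x by a fixed length e beyond x, to z. As h varies
    by at most 2 near p, convexity on [y, z] bounds the slope on [y, x] by
    2 / e. *)
Lemma convex_locally_lipschitz (R : realType) (V : normedModType R)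
    (h : V -> R) (p : V) :
  convex_function setT h -> {for p, continuous h} -> locally_lipschitz h p.
Proof.
move=> cvxh conth.
have /nbhs_ballP[r /= r0 hr] : \forall x \near p, `|h p - h x| < 1.
  by move/cvgrPdist_lt : conth; apply.
pose e := r / 2; have e0 : 0 < e by rewrite divr_gt0.
exists (2 / e), e; split=> [|//|x y px py]; first by rewrite divr_ge0// ltW.
have [->|xy] := eqVneq x y; first by rewrite subrr normr0 mulr0 addr0.
set D := `|x - y|; have D0 : 0 < D by rewrite normr_gt0 subr_eq0.
pose z := x + (e / D) *: (x - y).
have pz : ball p r z.
  rewrite -ball_normE /= /z opprD addrA (le_lt_trans (ler_normB _ _))//.
  rewrite normrZ ger0_norm ?divr_ge0 ?ltW// -/D divfK ?gt_eqF//.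
  by move: px; rewrite -ball_normE /= => px; rewrite (splitr r) ltrD2r.
pose l := D / (e + D).
have eD0 : 0 < e + D by rewrite addr_gt0.
have l01 : 0 <= l <= 1.
  apply/andP; split; first by rewrite divr_ge0// ltW.
  by rewrite ler_pdivrMr// mul1r lerDr ltW.
(* x as a convex combination of z and y, written with u = x - y. *)
have comb (u : V) k : l + l * k = 1 ->
    u + y = l *: (u + y + k *: u) + (1 - l) *: y.
  move=> lk; rewrite scalerBl scale1r -{1}[u]scale1r -lk.
  rewrite !scalerDr scalerA scalerDl [l *: u + l *: y + _]addrAC -[RHS]addrA.
  by rewrite [_ *: y + _]addrCA subrr addr0.
have xE : x = l *: z + (1 - l) *: y.
  have lk : l + l * (e / D) = 1 by rewrite /l; field; rewrite !gt_eqF.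
  by have := comb (x - y) _ lk; rewrite subrK.
rewrite {1}xE (le_trans (convex_function_comb cvxh _ _ l01))//.
have hz : h z <= h p + 1.
  by have := hr _ pz; rewrite /= ltr_norml => /andP[]; lra.
have hy : h p - 1 <= h y.
  have /hr : ball p r y.
    by apply: le_ball py; rewrite /e; lra.
  by rewrite /= ltr_norml => /andP[]; lra.
have : l * (h z - h y) <= l * 2 by rewrite ler_wpM2l//; [case/andP: l01|lra].
have : l <= D / e by rewrite ler_pM2l// lef_pV2// lerDl ltW.
rewrite -[2 / e * D]mulrA [e^-1 * D]mulrC.
set k := D / e.
move=> lk lz; move: lk lz; clearbody l k; lra.
Qed.

(** The hypothesis on psi expresses that it is a monotone function of the g i
    that commutes with adding a constant; this covers maxima, positive parts and
    order statistics at once. *)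
Lemma locally_lipschitz_aggregate (R : realType) (V : normedModType R)
    (I : finType) (g : I -> V -> R) (psi : V -> R) (p : V) :
  (forall x y c, 0 <= c -> (forall i, g i x <= g i y + c) ->
    psi x <= psi y + c) ->
  (forall i, locally_lipschitz (g i) p) -> locally_lipschitz psi p.
Proof.
move=> psig lipg.
have /choice[q lipq] : forall i, exists q : R * R,
    [/\ 0 <= q.1, 0 < q.2 & lipschitz_around (g i) q.1 q.2 p].
  by move=> i; have [L [e lipe]] := lipg i; exists (L, e).
pose L i := (q i).1; pose e i := (q i).2.
have L0 i : 0 <= L i by case: (lipq i).
near (0 : R)^'+ => r.
have re : forall i, r <= e i.
  near: r; apply: filter_forall => j.
  by apply: nbhs_right_le; case: (lipq j).
exists (\sum_i L i), r; split=> [|//|x y px py]; first by rewrite sumr_ge0.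
apply: psig => [|i]; first by rewrite mulr_ge0// sumr_ge0.
have [_ _ lipi] := lipq i.
apply: le_trans (lipi _ _ (le_ball (re i) px) (le_ball (re i) py)) _.
by rewrite lerD2l ler_wpM2r// (bigD1 i)//= lerDl sumr_ge0.
Unshelve. all: by end_near. Qed.

Lemma locally_lipschitz_continuous (R : realType) (V : normedModType R)
    (psi : V -> R) (p : V) :
  locally_lipschitz psi p -> {for p, continuous psi}.
Proof.
move=> [L [r [L0 r0 lip]]]; apply/cvgrPdist_le => /= eps eps0.
have L1 : 0 < L + 1 by rewrite ltr_wpDl.
have rL : 0 < Num.min r (eps / (L + 1)) by rewrite lt_min r0 divr_gt0.
near=> x.
have xp : ball p (Num.min r (eps / (L + 1))) x by near: x; exact: near_ball.
have px : ball p r x by apply: le_ball xp; rewrite ge_min lexx.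
have pp : ball p r p by exact: ballxx.
have : (L + 1) * `|p - x| <= eps.
  rewrite mulrC -ler_pdivlMr// ltW//.
  by move: xp; rewrite -ball_normE /= lt_min => /andP[].
have := lip _ _ px pp; have := lip _ _ pp px; rewrite [`|x - p|]distrC.
have := normr_ge0 (p - x).
by rewrite ler_norml => ? ? ? ?; apply/andP; split; nra.
Unshelve. all: by end_near. Qed.

(** * Exact penalization *)

(** Since the Clarke derivative is a limsup over base points as well as step
    lengths, a negative value yields one decrease rate valid at all base points
    near p. *)
Lemma clarke_derivative_lt0 (R : realType) (V : normedModType R) (psi : V -> R)
    (p v : V) :
  (clarke_derivative psi p v < 0)%E ->
  exists2 c : R, 0 < c &
    \forall r \near 0^'+, forall x t, ball p r x -> 0 < t < r ->
      psi (x + t *: v) <= psi x - c * t.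
Proof.
move=> /ereal_inf_lt[_ [A [[P Q] /= [Pp Q0] PQA] <-]] supA0.
have [c c0 supc] : exists2 c : R, 0 < c &
    (ereal_sup [set ((psi (q.1 + q.2 *: v) - psi q.1) / q.2)%:E | q in A]
       <= (- c)%:E)%E.
  move: supA0; case: ereal_sup => [s|//|_]; last by exists 1; rewrite ?leNye.
  by rewrite lte_fin => s0; exists (- s); rewrite ?oppr_gt0// opprK.
exists c => //.
move/nbhs_ballP: Pp => [r1 /= r10 Pr]; move/nbhs_ballP: Q0 => [r2 /= r20 Qr].
near=> r => x t px /andP[t0 tr].
have /PQA At : (P `*` Q) (x, t).
  split => /=.
    by apply: Pr; apply: le_ball px; near: r; exact: nbhs_right_le.
  apply: Qr => //; rewrite -ball_normE /= sub0r normrN gtr0_norm//.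
  rewrite (lt_le_trans tr)//.
  by near: r; exact: nbhs_right_le.
have := le_trans (ereal_sup_ubound (imageP _ At)) supc.
by rewrite lee_fin /= ler_pdivrMr//; lra.
Unshelve. all: by end_near. Qed.

(** The tangent direction v need not point into X, but it is a limit of
    directions t (w - p) with w in X. From a point x of X the direction t (w - x)
    is the usable one: short steps along it stay in X when X is convex. Using it
    instead of v changes psi by at most L (|t (w - p) - v| + t |p - x|) per unit
    of step, which is at most c / 2 once w is well chosen and x is close to p. *)
Lemma feasible_descent_step (R : realType) (V : normedModType R) (X : set V)
    (psi : V -> R) (p v : V) :
  locally_lipschitz psi p -> tangent_cone X p v ->
  (clarke_derivative psi p v < 0)%E ->
  exists2 w, X w & exists t c : R, [/\ 0 <= t, 0 < c &
    \forall x \near p, \forall tau \near 0^'+,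
      psi (x + (tau * t) *: (w - x)) <= psi x - c * tau].
Proof.
move=> [L [r [L0 r0 lip]]] Tv /clarke_derivative_lt0[c c0 desc].
have L1 : 0 < L + 1 by rewrite ltr_wpDl.
(* L + 1 rather than L avoids a separate treatment of L = 0; the two error terms
   may each take a quarter of c. *)
have eps0 : 0 < c / (L + 1) / 4 by rewrite !divr_gt0.
have [_ [[t [w [t0 Xw ->]]] vw]] := Tv _ (nbhsx_ballx v _ eps0).
exists w => //; exists t, (c / 2); split => //; first by rewrite divr_gt0.
near (0 : R)^'+ => k.
have k0 : 0 < k by [].
have kr : k <= r by near: k; exact: nbhs_right_le.
have desck : forall x tau, ball p k x -> 0 < tau < k ->
  psi (x + tau *: v) <= psi x - c * tau by near: k.
have small (u : V) : \forall s \near 0^'+, s * `|u| < r / 2.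
  near=> s; have u1 : 0 < `|u| + 1 by rewrite ltr_wpDl.
  have : s * (`|u| + 1) < r / 2.
    by rewrite -ltr_pdivlMr//; near: s; apply: nbhs_right_lt; rewrite !divr_gt0.
  by apply: le_lt_trans; rewrite ler_wpM2l ?lerDl// ltW.
near=> x; near=> tau.
have tau0 : 0 < tau by [].
have taukk : tau < k by near: tau; exact: nbhs_right_lt.
have xk : ball p k x by near: x; exact: near_ball.
have nball (u : V) : tau * `|u| < r / 2 -> ball p r (x + tau *: u).
  move=> ur; rewrite -ball_normE /= opprD addrA (le_lt_trans (ler_normB _ _))//.
  rewrite normrZ (gtr0_norm tau0) (splitr r) ltrD//.
  have : ball p (r / 2) x by near: x; apply: near_ball; rewrite divr_gt0.
  by rewrite -ball_normE.
have pw : ball p r (x + tau *: (t *: (w - x))).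
  by apply: nball; near: tau; exact: small.
have pv : ball p r (x + tau *: v) by apply: nball; near: tau; exact: small.
have distE : `|x + tau *: (t *: (w - x)) - (x + tau *: v)| =
    tau * `|t *: (w - p) - v + t *: (p - x)|.
  rewrite opprD addrACA subrr add0r -scalerBr normrZ (gtr0_norm tau0).
  congr (_ * `|_|).
  by rewrite [RHS]addrAC -scalerDr addrA subrK.
set N := `|t *: (w - p) - v + t *: (p - x)| in distE.
have N0 : 0 <= N by exact: normr_ge0.
have NL : (L + 1) * N <= c / 2.
  rewrite mulrC -ler_pdivlMr//.
  have -> : c / 2 / (L + 1) = c / (L + 1) / 4 + c / (L + 1) / 4.
    by field; rewrite gt_eqF.
  apply: le_trans (ler_normD _ _) _; apply: lerD; last first.
    rewrite normrZ ger0_norm//.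
    apply: (@le_trans _ _ ((t + 1) * `|p - x|)).
      by rewrite ler_wpM2r// lerDl.
    rewrite mulrC -ler_pdivlMr ?ltr_wpDl//.
    have : ball p (c / (L + 1) / 4 / (t + 1)) x.
      by near: x; apply: near_ball; rewrite divr_gt0// ltr_wpDl.
    by rewrite -ball_normE => /ltW.
  by move: vw; rewrite -ball_normE /= distrC => /ltW.
have LN : L * N <= c / 2 by rewrite (le_trans _ NL)// mulrDl mul1r lerDl.
have := desck _ _ xk (introT andP (conj tau0 taukk)).
have := lip _ _ pw pv; rewrite distE scalerA mulrCA.
have : tau * (L * N) <= tau * (c / 2) by rewrite ler_wpM2l// ltW.
by clear; move: (psi _) (psi _) (psi _) (L * N) => *; nra.
Unshelve. all: by end_near. Qed.

(** A constraint qualification that only speaks of points with psi p = 0 is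
    enough: minimizers of f + (n + 1) psi^+ that violate the constraint do so by
    O(1 / n), hence cluster at such points. *)
Lemma exact_penalty (R : realType) (V : normedModType R) (X : set V)
    (f psi : V -> R) (v0 : R) :
  compact X -> convex_set X -> {within X, continuous f} ->
  convex_function X (f : V -> R^o) ->
  (forall p, X p -> locally_lipschitz psi p) ->
  (forall p, X p -> psi p = 0 ->
    exists2 v, tangent_cone X p v & (clarke_derivative psi p v < 0)%E) ->
  (forall x, X x -> psi x <= 0 -> v0 <= f x) ->
  exists2 k : R, 0 < k & forall x, X x -> v0 <= f x + k * Num.max (psi x) 0.
Proof.
move=> cptX cvxX contf cvxf lip cq lbf; apply: contrapT => nopen.
have penlip p : X p -> locally_lipschitz (fun x => Num.max (psi x) 0) p.
  move=> /lip lippsi; pose g (_ : unit) := psi.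
  apply: (@locally_lipschitz_aggregate _ _ _ g) => // x y c c0 /(_ tt) gxy.
  rewrite ge_max; apply/andP; split; last first.
    by rewrite addr_ge0// le_max lexx orbT.
  by rewrite (le_trans gxy)// lerD2r le_max lexx.
pose F n x := f x + n.+1%:R * Num.max (psi x) 0.
have contF n : {within X, continuous (F n)}.
  apply: within_continuousD => //; apply: continuous_in_subspaceT => p.
  rewrite inE => Xp; apply: cvgM; first exact: cvg_cst.
  exact: (locally_lipschitz_continuous (penlip p Xp)).
have bad n : exists2 x, X x & F n x < v0.
  apply: contrapT => nobad; apply: nopen; exists n.+1%:R => // x Xx.
  by rewrite leNgt; apply/negP => Fx; apply: nobad; exists x.
have X0 : X !=set0 by have [x Xx _] := bad 0; exists x.
have [xa _ fa] := compact_EVT_min X0 cptX contf.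
have [xb _ fb] := compact_EVT_max X0 cptX contf.
have /choice[u uP] : forall n, exists u : V,
    [/\ X u, 0 < psi u, F n u < v0 & forall y, X y -> F n u <= F n y].
  move=> n; have [x Xx Fx] := bad n.
  have [u] := compact_EVT_min X0 cptX (contF n); rewrite inE => Xu Fu.
  have Fuv : F n u < v0 by rewrite (le_lt_trans (Fu _ (mem_set Xx))).
  exists u; split => // [|y Xy]; last exact/Fu/mem_set.
  rewrite ltNge; apply/negP => psiu; have := lbf u Xu psiu.
  apply/negP; rewrite -ltNge (le_lt_trans _ Fuv)// lerDl mulr_ge0//.
  by rewrite le_max lexx orbT.
have FE n : F n (u n) = f (u n) + n.+1%:R * psi (u n).
  by have [_ /ltW psi0 _ _] := uP n; rewrite /F max_l.
have archi (r : R) : exists N, forall n, (N <= n)%N -> r < n.+1%:R.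
  exists (Num.bound `|r|) => n Nn; rewrite (le_lt_trans (ler_norm r))//.
  by rewrite (lt_le_trans (archi_boundP (normr_ge0 r)))// ler_nat leqW.
have [p [Xp clp]] : X `&` cluster (u @ \oo) !=set0.
  by apply: cptX; exists 0%N => // n _ /=; have [] := uP n.
have often P : (\forall x \near p, P x) ->
    forall N, exists2 n, (N <= n)%N & P (u n).
  move=> nP N.
  have uN : (u @ \oo) (u @` [set n | (N <= n)%N]).
    by exists N => // n Nn; exists n.
  by have [_ [[n Nn <-] Pn]] := clp _ _ uN nP; exists n.
have contp : {for p, continuous psi} by exact/locally_lipschitz_continuous/lip.
(* psi (u n) is positive and at most (v0 - min f) / (n + 1). *)
have psip0 : psi p = 0.
  apply/eqP; rewrite eq_le !leNgt; apply/andP; split; apply/negP => psip.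
    have [N HN] := archi ((v0 - f xa) / (psi p / 2)).
    have p2 : 0 < psi p / 2 by rewrite divr_gt0.
    have [|n Nn pn] := often (fun x => psi p / 2 < psi x) _ N.
      by apply: (cvgr_gt (psi p)) => //; lra.
    have [Xu _ Fu _] := uP n; have fau := fa _ (mem_set Xu).
    have := HN n Nn; rewrite ltr_pdivrMr// => v0n.
    have : n.+1%:R * (psi p / 2) <= n.+1%:R * psi (u n).
      by rewrite ler_pM2l// ltW.
    by move: Fu; rewrite FE; lra.
  have [|n _ pn] := often (fun x => psi x < 0) _ 0.
    exact: (cvgr_lt (psi p)).
  by have [_ psi0 _ _] := uP n; rewrite ltNge ltW in pn.
have [v Tv dv] := cq p Xp psip0.
have [w Xw [t [c [t0 c0 desc]]]] := feasible_descent_step (lip p Xp) Tv dv.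
(* Beyond this index the saving (n + 1) c in the penalty exceeds the largest
   possible increase t (max f - min f) of f. *)
have [N HN] := archi (t * (f xb - f xa) / c).
have [n Nn descn] := often _ desc N.
have [Xu psi0 _ Fmin] := uP n.
near (0 : R)^'+ => tau.
have tau0 : 0 < tau by [].
have tauP : psi (u n + (tau * t) *: (w - u n)) <= psi (u n) - c * tau.
  by near: tau.
(* The step is short enough for the bound on psi at its end to be nonnegative,
   so that it also bounds the positive part of psi there. *)
have taupsi : c * tau <= psi (u n).
  rewrite mulrC -ler_pdivlMr//; near: tau; apply: nbhs_right_le.
  by rewrite divr_gt0.
have s01 : 0 <= tau * t <= 1.
  apply/andP; split; first by rewrite mulr_ge0// ltW.
  apply: (@le_trans _ _ (tau * (t + 1))).
    by rewrite ler_pM2l// lerDl.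
  rewrite -ler_pdivlMr ?ltr_wpDl//; near: tau; apply: nbhs_right_le.
  by rewrite divr_gt0 ?ltr_wpDl.
set s := tau * t in tauP s01.
have newE : u n + s *: (w - u n) = s *: w + (1 - s) *: u n.
  by rewrite scalerBr scalerBl scale1r addrCA.
rewrite newE in tauP.
have := Fmin _ (convex_set_comb cvxX Xw Xu s01); rewrite FE; apply/negP.
rewrite -ltNge /F.
have fnew := convex_function_comb cvxf Xw Xu s01.
have pennew : Num.max (psi (s *: w + (1 - s) *: u n)) 0 <= psi (u n) - c * tau.
  by rewrite ge_max tauP subr_ge0.
have := HN n Nn; rewrite ltr_pdivrMr// => kc.
have fdiff : s * (f w - f (u n)) <= s * (f xb - f xa).
  by case/andP: s01 => s0 _; rewrite ler_wpM2l// lerB// ?fa ?fb ?inE.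
have : n.+1%:R * Num.max (psi (s *: w + (1 - s) *: u n)) 0 <=
       n.+1%:R * (psi (u n) - c * tau) by rewrite ler_pM2l.
have : s * (f xb - f xa) < n.+1%:R * (c * tau).
  by rewrite /s -mulrA [ltRHS]mulrA [ltRHS]mulrC ltr_pM2l.
lra.
Unshelve. all: by end_near. Qed.

(** * Order statistics and the complementarity penalty *)

Section OrderStatistics.
Context (R : realType) (V : Type) (nS : nat) (g : 'I_nS -> V -> R).

Lemma count_sort_values (P : pred R) (x : V) :
  count P (sort <=%O [seq g s x | s <- enum 'I_nS]) = #|[pred s | P (g s x)]|.
Proof. by rewrite count_sort count_map cardE size_filter enumT. Qed.

(** Counting the scenarios below a level turns statements on order statistics
    into inclusions of index sets, with no further mention of sorting. *)
Lemma order_stat_le (k : nat) (x : V) (c : R) : (0 < k <= nS)%N ->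
  (order_stat g k x <= c) = (k <= #|[pred s | (g s x <= c)%R]|)%N.
Proof.
case: k => // k /= kn; rewrite -(count_sort_values (<= c)%O) /order_stat /=.
set vals := sort _ _.
have sorted_vals : sorted <=%O vals by exact: sort_le_sorted.
have size_vals : size vals = nS by rewrite size_sort size_map size_enum_ord.
apply/idP/idP => [|kc]; last exact: nth_count_le.
apply: contraLR; rewrite -ltNge -leqNgt => ck.
by apply: nth_count_gt; rewrite // size_vals kn andbT.
Qed.

Lemma card_lt_order_stat (k : nat) (x : V) : (0 < k)%N ->
  (#|[pred s | (g s x < order_stat g k x)%R]| < k)%N.
Proof.
case: k => // k _; rewrite ltnNge; apply/negP => kc.
have := @nth_count_lt _ _ (order_stat g k.+1 x) 0 _ k
  (sort_le_sorted [seq g s x | s <- enum 'I_nS]).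
by rewrite (count_sort_values (< _)%O) ltxx => /(_ kc).
Qed.

Lemma order_stat_monotone (k : nat) (x y : V) (c : R) : (0 < k <= nS)%N ->
  (forall s, g s x <= g s y + c) -> order_stat g k x <= order_stat g k y + c.
Proof.
move=> kn gxy; rewrite order_stat_le//.
have : (k <= #|[pred s | (g s y <= order_stat g k y)%R]|)%N.
  by rewrite -order_stat_le.
move/leq_trans; apply; apply/subset_leq_card/fintype.subsetP => s.
by rewrite !inE => gs; rewrite (le_trans (gxy s))// lerD2r.
Qed.

Lemma phiE (m : nat) (x : V) :
  phi g m x = order_stat g (nS - m) x.
Proof. by rewrite /phi /G1 big_ltn ?ltnS ?leq_subr// addrK. Qed.

(** As y dominates both g x and 0, the terms of Vpen y z with phi x <= g s x are
    at least phi x * z s. The other scenarios number at most nS - m - 1 and each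
    z s is at most 1, so these terms carry total weight at least 1. *)
Lemma phi_le_Vpen (m : nat) (x : V) (y z : 'rV[R]_nS) : (m < nS)%N ->
  (forall s, 0 <= y 0 s) -> (forall s, 0 <= z 0 s <= 1) ->
  nS%:R - m%:R <= \sum_(s < nS) z 0 s -> (forall s, g s x <= y 0 s) ->
  Num.max (phi g m x) 0 <= Vpen y z.
Proof.
move=> mS y0 z01 sumz gy.
have z0 s : 0 <= z 0 s by case/andP: (z01 s).
have yz0 s : 0 <= y 0 s * z 0 s by rewrite mulr_ge0.
have [phi0|/ltW phi0] := leP (phi g m x) 0; first by rewrite sumr_ge0.
have k0 : (0 < nS - m)%N by rewrite subn_gt0.
pose big_s (s : 'I_nS) := phi g m x <= g s x.
have small_lt : \sum_(s | ~~ big_s s) z 0 s <= nS%:R - m%:R - 1.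
  apply: (@le_trans _ _ (\sum_(s | ~~ big_s s) 1)).
    by apply: ler_sum => s _; case/andP: (z01 s).
  rewrite sumr_const lerBrDr natr1 -natrB ?ler_nat; last exact: ltnW.
  apply: leq_ltn_trans (card_lt_order_stat x k0).
  by apply/eq_leq/eq_card => s; rewrite !inE /big_s phiE ltNge.
have big_ge : 1 <= \sum_(s | big_s s) z 0 s.
  by move: sumz; rewrite (bigID big_s)/=; lra.
apply: (@le_trans _ _ (\sum_(s | big_s s) y 0 s * z 0 s)); last first.
  by rewrite /Vpen [leRHS](bigID big_s)/= lerDl sumr_ge0.
apply: (@le_trans _ _ (phi g m x * \sum_(s | big_s s) z 0 s)).
  by rewrite ler_peMr.
rewrite mulr_sumr; apply: ler_sum => s bs.
by rewrite ler_wpM2r// (le_trans bs).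
Qed.

(** Take y = g^+ x and let z select the satisfied scenarios, which makes y and z
    complementary. *)
Lemma feasible_B_lift (m : nat) (X : set V) (x : V) : (m < nS)%N ->
  X x -> phi g m x <= 0 ->
  exists y z, feasible_B g m X (x, y, z).
Proof.
move=> mS Xx; rewrite phiE order_stat_le; last by rewrite subn_gt0 mS leq_subr.
move=> card0.
exists (\row_s Num.max (g s x) 0), (\row_s ((g s x <= 0)%R)%:R).
split; last first.
  rewrite /Vpen big1// => s _; rewrite !mxE.
  by have [gs|_] := leP (g s x) 0; rewrite ?mul0r ?mulr0.
split => // [s|s||s]; rewrite ?mxE.
- by rewrite le_max lexx orbT.
- by case: (g s x <= 0); rewrite ?lexx ?ler01.
- under eq_bigr do rewrite mxE.
  rewrite -natr_sum -natrB ?ler_nat; last exact: ltnW.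
  by rewrite (leq_trans card0)// -sum1_card big_mkcond leq_sum.
- by rewrite le_max lexx.
Qed.

End OrderStatistics.

Lemma scenario_max_locally_lipschitz (R : realType) (V : normedModType R)
    (nS nI : nat) (hI : (0 < nI)%N) (h : 'I_nS -> 'I_nI -> V -> R) (s : 'I_nS)
    (p : V) :
  (forall i, locally_lipschitz (h s i) p) ->
  locally_lipschitz (scenario_max hI h s) p.
Proof.
apply: locally_lipschitz_aggregate => x y c c0 hxy.
have hle i : h s i x <= scenario_max hI h s y + c.
  by rewrite (le_trans (hxy i))// lerD2r le_bigmax.
by apply/bigmax_leP; split.
Qed.

Lemma phi_locally_lipschitz (R : realType) (V : normedModType R) (nS m : nat)
    (g : 'I_nS -> V -> R) (p : V) : (m < nS)%N ->
  (forall s, locally_lipschitz (g s) p) -> locally_lipschitz (phi g m) p.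
Proof.
move=> mS; apply: locally_lipschitz_aggregate => x y c c0 gxy.
rewrite !phiE; apply: order_stat_monotone => //.
by rewrite subn_gt0 mS leq_subr.
Qed.

Theorem theorem3p3 (R : realType) (d nS nI m : nat) (alpha : R)
  (hS : (0 < nS)%N) (hI : (0 < nI)%N)
  (alpha_gt0 : 0 < alpha) (alpha_lt1 : alpha < 1)
  (hm : m%:Z = Num.floor (alpha * nS%:R))
  (X U : set 'rV[R]_d)
  (Xcompact : compact X) (Xconvex : convex_set X)
  (Xrelint : relative_interior X !=set0)
  (Uopen : open U) (XU : X `<=` U)
  (f : 'rV[R]_d -> R) (fC1 : C1_on U f) (fconvex : convex_on U f)
  (h : 'I_nS -> 'I_nI -> 'rV[R]_d -> R)
  (hC1 : forall s i, C1_on setT (h s i))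
  (hconvex : forall s i, convex_on setT (h s i))
  (hCQ : CQ (scenario_max hI h) m X)
  (xbar : 'rV[R]_d) (ybar zbar : 'rV[R]_nS)
  (feas : feasible_Bsigma (scenario_max hI h) m X (xbar, ybar, zbar)) :
  global_minimizer (feasible_B (scenario_max hI h) m X) (objective_B f)
    (xbar, ybar, zbar)
  <->
  Vpen ybar zbar = 0 /\
  exists2 sigmabar : R, 0 < sigmabar &
    forall sigma : R, sigmabar < sigma ->
      global_minimizer (feasible_Bsigma (scenario_max hI h) m X)
        (objective_Bsigma f sigma) (xbar, ybar, zbar).
Proof.
set g := scenario_max hI h in hCQ feas *.
have mS : (m < nS)%N.
  rewrite -(ltr_nat R) (@le_lt_trans _ _ (alpha * nS%:R))//; last first.
    by rewrite gtr_pMl// ltr0n.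
  by have := ge_floor (alpha * nS%:R); rewrite -hm.
(* Given a solution for every large sigma, any of these sigma will do, because
   the penalty vanishes on the feasible set of (B). *)
split=> [[[_ V0] minB]|[V0 [sigmabar sigmabar0 minBs]]]; last first.
  split=> // -[[x y] z] [feasx Vyz].
  have [_ /(_ (x, y, z) feasx)] := minBs _ (ltr_pwDr ltr01 (lexx sigmabar)).
  by rewrite /objective_Bsigma /objective_B Vyz V0 !mulr0 !addr0.
split=> //.
have [sigmabar sigmabar0 pen] : exists2 k : R, 0 < k &
    forall x, X x -> f xbar <= f x + k * Num.max (phi g m x) 0.
  apply: exact_penalty => // [|||x Xx phix0].
  - apply: continuous_in_subspaceT => x; rewrite inE => Xx.
    by have [/differentiable_continuous] := fC1 x (XU x Xx).
  - exact: fconvex.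
  - move=> p _; apply: phi_locally_lipschitz => // s.
    apply: scenario_max_locally_lipschitz => i.
    apply: convex_locally_lipschitz; last first.
      by have [/differentiable_continuous] := hC1 s i p I.
    by apply: hconvex => // x y t; rewrite !inE.
  - have [y [z feasB]] := feasible_B_lift mS Xx phix0.
    exact: minB feasB.
exists sigmabar => // sigma sigmabar_lt.
split=> // -[[x y] z] [Xx y0 z01 sumz gy].
rewrite /objective_Bsigma V0 mulr0 addr0 (le_trans (pen x Xx))// lerD2l.
apply: ler_pM => //; [exact: ltW|by rewrite le_max lexx orbT|exact: ltW|].
exact: phi_le_Vpen.
Qed.
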